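(* Let $X$ be a nonempty set and let $F_1\colon X\to X$ and $F_2\colon X^2\to X$ be two operations. Then there exists an associative $\varepsilon$-standard operation $G\colon X^*\to X\cup\{\varepsilon\}$ such that $G_1=F_1$ and $G_2=F_2$ if and only if the following three conditions hold: (i) $F_1\circ F_1=F_1$ and $F_1\circ F_2=F_2$; (ii) $F_2=F_2\circ(F_1,\mathrm{id})=F_2\circ(\mathrm{id},F_1)$; (iii) $F_2$ is associative, i.e., $F_2(F_2(xy)z)=F_2(xF_2(yz))$ for all $x,y,z\in X$. Such an operation $G$ is then uniquely determined by $G_n=G_2\circ(G_{n-1},\mathrm{id})$ for $n\geqslant 3$.
   Context: $X^*=\bigcup_{n\geqslant 0}X^n$ is the set of all finite strings over $X$ (vectors in $X^n$ are regarded as strings of length $n$), with $X^0=\{\varepsilon\}$, where $\varepsilon$ is the empty string ($\varepsilon\notin X$). Concatenation is denoted by juxtaposition, and $\varepsilon$ is neutral for it. For a function $G$ on $X^*$, $G_n=G|_{X^n}$ is its $n$-ary part. An operation $G\colon X^*\to X\cup\{\varepsilon\}$ is $\varepsilon$-standard if $G(\varepsilon)=\varepsilon$ and $G(\mathbf{x})=\varepsilon$ only if $\mathbf{x}=\varepsilon$ (so $G_n$ maps $X^n$ into $X$ for $n\geqslant 1$). It is associative if $G(\mathbf{x}\mathbf{y}\mathbf{z})=G(\mathbf{x}\,G(\mathbf{y})\,\mathbf{z})$ for all $\mathbf{x},\mathbf{y},\mathbf{z}\in X^*$, where $G(\mathbf{y})\in X\cup\{\varepsilon\}$ is regarded as a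 string of length at most one. $\mathrm{id}$ is the identity on $X$, and for functions $f,g$ of arities $m,n$, $(f,g)(\mathbf{x}\mathbf{y})=f(\mathbf{x})g(\mathbf{y})$ for $|\mathbf{x}|=m$, $|\mathbf{y}|=n$; e.g. $(F_2\circ(F_1,\mathrm{id}))(x_1x_2)=F_2(F_1(x_1)x_2)$ and $(G_2\circ(G_{n-1},\mathrm{id}))(x_1\cdots x_n)=G_2(G_{n-1}(x_1\cdots x_{n-1})x_n)$. *)

(* Defs.v *)
From mathcomp Require Import all_boot.

Set Implicit Arguments.
Unset Strict Implicit.
Unset Printing Implicit Defensive.

(* A string over X is a [seq X]; the set X u {eps} is
   [option X] with [None] for eps, and [seq_of_opt] is the inclusion of
   X u {eps} into strings. *)

Section Operations.

Variable X : Type.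

Definition eps_standard (G : seq X -> option X) : Prop :=
  G [::] = None /\ forall s, G s = None -> s = [::].

Definition string_associative (G : seq X -> option X) : Prop :=
  forall x y z : seq X, G (x ++ y ++ z) = G (x ++ seq_of_opt (G y) ++ z).

Definition unary_part_is (G : seq X -> option X) (F1 : X -> X) : Prop :=
  forall x, G [:: x] = Some (F1 x).

Definition binary_part_is (G : seq X -> option X) (F2 : X -> X -> X) : Prop :=
  forall x y, G [:: x; y] = Some (F2 x y).

(* G_n = G_2 o (G_(n-1), id) for n >= 3: for an eps-standard G and nonempty s,
   [seq_of_opt (G s)] has length one, so the right-hand side is a value of
   G_2. *)
Definition fold_recurrence (G : seq X -> option X) : Prop :=
  forall n, 3 <= n -> forall (s : seq X) (y : X), size s = n.-1 ->
    G (rcons s y) = G (seq_of_opt (G s) ++ [:: y]).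

End Operations.

(* Main.v *)
Require Import Defs.
From mathcomp Require Import all_boot.

(* Associativity allows the prefix of all letters but the last to be replaced
   by its value, which is the recurrence [G_n = G_2 o (G_(n-1), id)]; a
   recurrence of this form leaves no freedom beyond [G_1] and [G_2].
   Conversely, the recurrence is solved by folding [F2] from the left, starting
   with [F1] of the first letter: by (iii) a block of letters inside the fold
   may be folded separately, and (i) and (ii) absorb the extra occurrence of
   [F1] this creates. *)

Section Parts.

Variables (X : Type) (F1 : X -> X) (F2 : X -> X -> X).

Lemma associative_fold_recurrence (G : seq X -> option X) :
  string_associative G -> fold_recurrence G.
Proof. by move=> assocG n _ s y _; rewrite -cats1; apply: (assocG [::]). Qed.

Lemma fold_recurrence_unique (G G' : seq X -> option X) :
    eps_standard G -> unary_part_is G F1 -> binary_part_is G F2 ->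
    fold_recurrence G ->
    eps_standard G' -> unary_part_is G' F1 -> binary_part_is G' F2 ->
    fold_recurrence G' ->
  G' =1 G.
Proof.
move=> stdG G1 G2 recG stdG' G'1 G'2 recG'.
elim/last_ind=> [|s y IHs]; first by rewrite stdG.1 stdG'.1.
(* Lengths one and two are fixed by [F1] and [F2]; the recurrence takes over from length three
   on. *)
case: s IHs => [|a [|b s]] IHs; rewrite ?G1 ?G'1 //= ?G2 ?G'2 //.
have recs H : fold_recurrence H -> H (rcons [:: a, b & s] y) =
    H (seq_of_opt (H [:: a, b & s]) ++ [:: y]).
  by move=> recH; apply: (recH (size s).+3).
rewrite -[a :: _]/(rcons [:: a, b & s] y) !recs // IHs.
by case: (G _) => [c|] /=; rewrite ?G2 ?G'2 ?G1 ?G'1.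
Qed.

(** Each identity is associativity on a string of at most three letters: (i) replaces the whole
    string, (ii) one letter out of two, (iii) two adjacent letters out of three. *)
Lemma associative_parts (G : seq X -> option X) :
    string_associative G -> unary_part_is G F1 -> binary_part_is G F2 ->
  [/\ (forall x, F1 (F1 x) = F1 x) /\ (forall x y, F1 (F2 x y) = F2 x y),
      (forall x y, F2 x y = F2 (F1 x) y) /\ (forall x y, F2 x y = F2 x (F1 y))
    & forall x y z, F2 (F2 x y) z = F2 x (F2 y z)].
Proof.
move=> assocG G1 G2; split; [split=> [x|x y] | split=> x y | move=> x y z];
  apply: Some_inj.
- by have := assocG [::] [:: x] [::]; rewrite /= G1 /= G1.
- by have := assocG [::] [:: x; y] [::]; rewrite /= G2 /= G1.
- by have := assocG [::] [:: x] [:: y]; rewrite /= G1 /= !G2.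
- by have := assocG [:: x] [:: y] [::]; rewrite /= G1 /= !G2.
have := assocG [::] [:: x; y] [:: z]; have := assocG [:: x] [:: y; z] [::].
by rewrite /= !G2 /= => -> ->.
Qed.

Definition string_fold (s : seq X) : option X :=
  if s is x :: t then Some (foldl F2 (F1 x) t) else None.

Lemma string_fold_eps_standard : eps_standard string_fold.
Proof. by split=> // -[]. Qed.

Hypothesis F1_idem : forall x, F1 (F1 x) = F1 x.
Hypothesis F1_F2 : forall x y, F1 (F2 x y) = F2 x y.
Hypothesis F2_F1l : forall x y, F2 x y = F2 (F1 x) y.
Hypothesis F2_F1r : forall x y, F2 x y = F2 x (F1 y).
Hypothesis F2A : forall x y z, F2 (F2 x y) z = F2 x (F2 y z).

Lemma string_fold_binary : binary_part_is string_fold F2.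
Proof. by move=> x y; rewrite /= -F2_F1l. Qed.

(** The accumulator stays a fixed point of [F1], since every value of [F2] is one. *)
Lemma F1_foldl a t : F1 a = a -> F1 (foldl F2 a t) = foldl F2 a t.
Proof. by elim: t a => //= b t IHt a _; apply: IHt. Qed.

(** Lets a separately folded block be merged into the fold of the letters before it. *)
Lemma F2_foldl x a t : F2 x (foldl F2 a t) = foldl F2 (F2 x a) t.
Proof. by elim: t a => //= b t IHt a; rewrite IHt F2A. Qed.

Lemma string_fold_associative : string_associative string_fold.
Proof.
move=> [|a s] [|b t] z //=; rewrite !foldl_cat //= ?foldl_cat.
  (* Empty prefix: the value of the block becomes the first letter, so [F1] hits it once more. *)
  by rewrite F1_foldl.
(* Nonempty prefix: after merging, the [F1] on the first letter of the block sits in the right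
   argument of [F2]. *)
by rewrite F2_foldl -F2_F1r.
Qed.

End Parts.

Theorem theorem3p5 (X : Type) (F1 : X -> X) (F2 : X -> X -> X)
  (X_nonempty : inhabited X) :
  ((exists G : seq X -> option X,
      [/\ eps_standard G, string_associative G,
          unary_part_is G F1 & binary_part_is G F2])
   <->
   [/\ (forall x, F1 (F1 x) = F1 x) /\ (forall x y, F1 (F2 x y) = F2 x y),
       (forall x y, F2 x y = F2 (F1 x) y) /\ (forall x y, F2 x y = F2 x (F1 y))
     & forall x y z, F2 (F2 x y) z = F2 x (F2 y z)])
  /\
  (forall G : seq X -> option X,
     [/\ eps_standard G, string_associative G,
         unary_part_is G F1 & binary_part_is G F2] ->
     [/\ fold_recurrence G,
         (forall G' : seq X -> option X,
            [/\ eps_standard G', string_associative G',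
                unary_part_is G' F1 & binary_part_is G' F2] -> G' =1 G)
       & (forall G' : seq X -> option X,
            [/\ eps_standard G', unary_part_is G' F1,
                binary_part_is G' F2 & fold_recurrence G'] -> G' =1 G)]).
Proof.
split=> [|G [stdG assocG G1 G2]].
  split=> [[G [_ assocG G1 G2]]|[[F1i F1F2] [F2l F2r] F2A]].
    exact: associative_parts assocG G1 G2.
  exists (string_fold X F1 F2); split=> //.
  - exact: string_fold_eps_standard.
  - exact: string_fold_associative.
  - exact: string_fold_binary.
have recG := associative_fold_recurrence _ _ assocG.
split=> // G' [stdG'].
  (* An associative competitor also satisfies the recurrence, so both uniqueness claims become
     one. *)
  move=> /associative_fold_recurrence recG' G'1 G'2.
  exact: (fold_recurrence_unique _ F1 F2).
by move=> G'1 G'2 recG'; apply: (fold_recurrence_unique _ F1 F2).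
Qed.
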